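(* Let $n\ge 2$. Suppose that $\Omega$ is a bounded convex domain in $\mathbb{R}^n$, $q\in[0,n)$, $a_i\ge 1$ for $i=1,\dots,n-1$, and denote $$\alpha=\frac{\bar a+2}{n-q},\qquad \bar a=\sum_{i=1}^{n-1}\frac{2}{a_i}.$$ Consider the problem $$\det D^2u=|u|^q\ \text{ in }\Omega,\qquad u=0\ \text{ on }\partial\Omega. \qquad (\ast)$$ (1) If $u\in C(\overline\Omega)$ is an Aleksandrov super-solution to $(\ast)$, $x_0\in\partial\Omega$, and $\Omega$ satisfies the $(a_1,\dots,a_{n-1})$-exterior convex condition at $x_0$ (with constants $\eta_1,\dots,\eta_{n-1}>0$), then $$|u(x)|\le C\,d_x^{\,\lambda}\quad\text{for all }x\in\Omega\text{ such that }d_x=|x-x_0|,$$ where $\lambda=\frac{\bar a+2}{n}$ in the case $n-\bar a-2>0$, $\lambda$ can be taken to be any number in $(0,1)$ in the case $n-\bar a-2\le 0$, and $C$ is a positive constant depending only on $n,q,\operatorname{diam}\Omega,\lambda$ and the numbers $a_1,\dots,a_{n-1},\eta_1,\dots,\eta_{n-1}$ in the exterior convex condition at $x_0$. (2) If $u\in C(\overline\Omega)$ is an Aleksandrov solution to $(\ast)$ and $\Omega$ is an $(a_1,\dots,a_{n-1})$-exterior convex domain (with constants $\eta_1,\dots,\eta_{n-1}>0$), then $$|u(x)|\le C\,d_x^{\,\lambda}\quad\text{for all }x\in\Omega,$$ where $\lambda$ can be taken to be any number in $(0,\alpha)$ in the case $q\in(0,n-\bar a-2)$, $\lambda$ can be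 taken to be any number in $(0,1)$ in the case $q\ge\max\{n-\bar a-2,\,0\}$, and $C$ is a positive constant depending only on $n,q,\operatorname{diam}\Omega,\lambda$ and the numbers $a_1,\dots,a_{n-1},\eta_1,\dots,\eta_{n-1}$ in the exterior convex condition.
   Context: Notation: $d_x=\operatorname{dist}(x,\partial\Omega)$. Exterior convex condition: Let $\Omega\subset\mathbb{R}^n$ be a bounded convex domain, $x_0\in\partial\Omega$, and $a_i\ge 1$ for $i=1,\dots,n-1$. $\Omega$ satisfies the $(a_1,\dots,a_{n-1})$-exterior convex condition at $x_0$ if there exist positive constants $\eta_1,\dots,\eta_{n-1}$ such that, after a suitable translation and rotation, $x_0=\mathbf 0$ and $$\Omega\subseteq\{x\in\mathbb{R}^n: x_n>\eta_1|x_1|^{a_1}+\cdots+\eta_{n-1}|x_{n-1}|^{a_{n-1}}\}.$$ If this holds at every $x_0\in\partial\Omega$ with the same positive constants $\eta_1,\dots,\eta_{n-1}$ (the translation and rotation may depend on $x_0$), then $\Omega$ is called an $(a_1,\dots,a_{n-1})$-exterior convex domain. Aleksandrov solutions: For $u\in C(\overline\Omega)$ convex in $\Omega$ and $z\in\Omega$, let $\partial u(z)=\{p\in\mathbb{R}^n: u(x)\ge u(z)+p\cdot(x-z)\text{ for all }x\in\Omega\}$, and $\partial u(E)=\bigcup_{z\in E}\partial u(z)$. The Monge–Ampère measure of $u$ is $\mathbb{M}u(E)=|\partial u(E)|$ (Lebesgue measure) for Borel sets $E\subset\Omega$. A function $u\in C(\overline\Omega)$, convex in $\Omega$, is an Aleksandrov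 super-solution (resp. solution) of $\det D^2u=|u|^q$ in $\Omega$ if $\mathbb{M}u\le|u(x)|^q\,dx$ (resp. $\mathbb{M}u=|u(x)|^q\,dx$) as measures in $\Omega$. It is an Aleksandrov super-solution (resp. solution) to the boundary value problem $(\ast)$ if in addition $u=0$ on $\partial\Omega$. *)

(* Defs.v *)
From HB Require Import structures.
From mathcomp Require Import all_boot all_order all_algebra.
From mathcomp Require Import all_classical all_reals all_analysis.

Set Implicit Arguments.
Unset Strict Implicit.
Unset Printing Implicit Defensive.

Import Order.TTheory GRing.Theory Num.Theory.
Import numFieldNormedType.Exports.

Local Open Scope classical_set_scope.
Local Open Scope ring_scope.

(* The library norm on 'rV[R]_n is the sup norm; it induces the right topology
   and the right bounded sets, but distances below must be Euclidean. *)
Definition dotp (R : realType) (n : nat) (x y : 'rV[R]_n) : R :=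
  \sum_(j < n) x ord0 j * y ord0 j.

Definition euclid_norm (R : realType) (n : nat) (x : 'rV[R]_n) : R :=
  Num.sqrt (dotp x x).

Definition bdry (T : topologicalType) (A : set T) : set T :=
  closure A `\` interior A.

Definition euclid_dist (R : realType) (n : nat) (x : 'rV[R]_n) (A : set 'rV[R]_n) : R :=
  inf [set euclid_norm (x - y) | y in A].

Definition euclid_diam (R : realType) (n : nat) (A : set 'rV[R]_n) : R :=
  sup [set euclid_norm (x - y) | x in A & y in A].

(* Connectedness is implied by convexity. *)
Definition bounded_convex_domain (R : realType) (n : nat) (Om : set 'rV[R]_n) :=
  [/\ open Om, Om !=set0, bounded_set Om & convex_set Om].

(* Lebesgue outer measure on R^n, by countable covers with half-open boxes.
   The dimension is m.+1 because in dimension 0 every box has volume 1. *)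
Section lebesgue_rV.
Context (R : realType) (m : nat).
Local Notation V := 'rV[R]_m.+1.
Implicit Types (A : set V) (I : V * V).

Definition box I : set V :=
  [set x | forall j, I.1 ord0 j <= x ord0 j < I.2 ord0 j].

Definition box_vol I : R := \prod_(j < m.+1) (I.2 ord0 j - I.1 ord0 j).

Definition box_cover A : set ((V * V)^nat) :=
  [set I : (V * V)^nat | (forall k j, (I k).1 ord0 j <= (I k).2 ord0 j) /\
           A `<=` \bigcup_k box (I k)].

Definition leb_outer A : \bar R :=
  ereal_inf [set (\sum_(k <oo) (box_vol (I k))%:E)%E | I in box_cover A].

Local Open Scope ereal_scope.

Lemma box_cover_vol_ge0 A (I : (V * V)^nat) k :
  box_cover A I -> 0 <= (box_vol (I k))%:E.
Proof.
move=> [Ile _]; rewrite lee_fin; apply: prodr_ge0 => j _.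
by rewrite subr_ge0.
Qed.

Lemma leb_outer_ge0 A : 0 <= leb_outer A.
Proof.
apply: le_ereal_inf_tmp => _ [I IA <-].
by apply: nneseries_ge0 => k _ _; exact: box_cover_vol_ge0 IA.
Qed.

Lemma leb_outer0 : leb_outer set0 = 0.
Proof.
apply/eqP; rewrite eq_le leb_outer_ge0 andbT.
apply: ereal_inf_lbound; exists (fun=> (0%R, 0%R)); first by split.
apply: eseries0 => k _ _; rewrite /box_vol (bigD1 ord0)//= subrr.
by rewrite mul0r.
Qed.

Lemma le_leb_outer : {homo leb_outer : A B / A `<=` B >-> A <= B}.
Proof.
move=> A B AB; apply: ereal_inf_le_tmp => _ [I [Ile BI] <-].
by exists I => //; split=> //; exact: subset_trans BI.
Qed.

Lemma leb_outer_sigma_subadditive : sigma_subadditive leb_outer.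
Proof.
move=> A; have [[i ioo]|] := pselect (exists i, leb_outer (A i) = +oo).
  rewrite (eseries_pinfty _ _ ioo) ?leey// => n _.
  by rewrite -ltNye (lt_le_trans _ (leb_outer_ge0 _)).
rewrite -forallNE => Aoo.
suff add2e (e : {posnum R}) :
    leb_outer (\bigcup_n A n) <= \sum_(i <oo) leb_outer (A i) + e%:num%:E.
  by apply/lee_addgt0Pr => _/posnumP[].
rewrite (le_trans _ (epsilon_trick _ _ _))//; last first.
  by move=> n; exact: leb_outer_ge0.
pose P n (B : (V * V)^nat) := box_cover (A n) B /\
  \sum_(k <oo) (box_vol (B k))%:E <=
    leb_outer (A n) + (e%:num / (2 ^ n.+1)%:R)%:E.
have [G PG] : {G : ((V * V)^nat)^nat & forall n, P n (G n)}.
  apply: (@choice _ _ P) => n; rewrite /P.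
  have fA : leb_outer (A n) \is a fin_num.
    by rewrite ge0_fin_numE ?leb_outer_ge0// ltey; exact/eqP/Aoo.
  have en1 : (0 < e%:num / (2 ^ n.+1)%:R)%R by [].
  have [_ [B BA <-] /ltW muB] := lb_ereal_inf_adherent en1 fA.
  by exists B.
pose w (p : nat * nat) : \bar R := (box_vol (G p.1 p.2))%:E.
have w_ge0 p : 0 <= w p by exact: box_cover_vol_ge0 (PG p.1).1.
apply: (@le_trans _ _ (\esum_(p in setT) w p)).
  have /card_esym/ppcard_eqP[f] := card_nat2.
  apply: ereal_inf_lbound => /=.
  exists (fun k => G (f k).1 (f k).2).
    split=> [k j|t [i _]]; first exact: (PG (f k).1).1.1.
    move=> /((PG i).1.2) [j _ Gt].
    by exists (f^-1%FUN (i, j)) => //=; rewrite invK ?inE.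
  rewrite -(esum_pred_image w _ xpredT) ?[fun=> _]set_true//.
  by rewrite image_eq.
rewrite (_ : esum _ _ = \sum_(i <oo) \sum_(j <oo) w (i, j)); last first.
  pose J : nat -> set (nat * nat) := fun i => [set (i, j) | j in setT].
  rewrite (_ : setT = \bigcup_k J k); last first.
    by rewrite predeqE => -[a b]; split => // _; exists a => //; exists b.
  rewrite esum_bigcupT /=; last 2 first.
    - apply/trivIsetP => i j _ _ ij.
      rewrite predeqE => -[n k] /=; split => //= -[] [_] _ [<-{n} _].
      by move=> [m' _] [] /esym/eqP; rewrite (negbTE ij).
    - by move=> /= p; exact: w_ge0.
  rewrite -(image_id [set: nat]) -fun_true esum_pred_image//; last first.
    by move=> n _; exact: esum_ge0.
  apply: eq_eseriesr => /= j _.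
  rewrite -(esum_pred_image w (pair j) predT)//=; last first.
    by move=> ? ? _ _; exact: (@can_inj _ _ _ snd).
  by congr esum; rewrite predeqE => -[a b]; split; move=> [i _ <-]; exists i.
apply: lee_nneseries => [i _ _|i _].
  by apply: nneseries_ge0 => j _ _; exact: w_ge0.
exact: (PG i).2.
Qed.

HB.instance Definition _ := isOuterMeasure.Build R V leb_outer
  leb_outer0 leb_outer_ge0 le_leb_outer leb_outer_sigma_subadditive.

End lebesgue_rV.

(* Lebesgue measure on the sigma-algebra of Lebesgue (Caratheodory) measurable
   subsets of R^(m+1); as a function of sets it is leb_outer itself. *)
Section leb_measure.
Context (R : realType) (m : nat).

Definition leb : set (caratheodory_type (@leb_outer R m)) -> \bar R :=
  @leb_outer R m.

HB.instance Definition _ := isMeasure.Build _ _ _ leb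
  (@caratheodory_measure0 _ _ (@leb_outer R m))
  (@caratheodory_measure_ge0 _ _ (@leb_outer R m))
  (@caratheodory_measure_sigma_additive _ _ (@leb_outer R m)).

End leb_measure.

Definition subdiff (R : realType) (n : nat) (Om : set 'rV[R]_n)
    (u : 'rV[R]_n -> R) (z : 'rV[R]_n) : set 'rV[R]_n :=
  [set p | forall x, Om x -> u z + dotp p (x - z) <= u x].

Definition MA (R : realType) (m : nat) (Om : set 'rV[R]_m.+1)
    (u : 'rV[R]_m.+1 -> R) (E : set 'rV[R]_m.+1) : \bar R :=
  leb (\bigcup_(z in E) subdiff Om u z).

(* u is a total function, but only its values on closure Om matter. *)
Definition convex_continuous (R : realType) (n : nat) (Om : set 'rV[R]_n)
    (u : 'rV[R]_n -> R) :=
  {within closure Om, continuous u} /\ convex_function Om u.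

(* Here 0 `^ 0 = 1, so that for q = 0 the right-hand side is dx. *)
Definition aleksandrov_supersolution (R : realType) (m : nat) (q : R)
    (Om : set 'rV[R]_m.+1) (u : 'rV[R]_m.+1 -> R) :=
  convex_continuous Om u /\
  forall E : set 'rV[R]_m.+1, <<s open >> E -> E `<=` Om ->
    (MA Om u E <= \int[@leb R m]_(x in E) (`|u x| `^ q)%:E)%E.

Definition aleksandrov_solution (R : realType) (m : nat) (q : R)
    (Om : set 'rV[R]_m.+1) (u : 'rV[R]_m.+1 -> R) :=
  convex_continuous Om u /\
  forall E : set 'rV[R]_m.+1, <<s open >> E -> E `<=` Om ->
    (MA Om u E = \int[@leb R m]_(x in E) (`|u x| `^ q)%:E)%E.

Definition dirichlet0 (R : realType) (n : nat) (Om : set 'rV[R]_n)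
    (u : 'rV[R]_n -> R) :=
  forall x, bdry Om x -> u x = 0.

Definition rotation (R : realType) (n : nat) (Q : 'M[R]_n) :=
  Q *m Q^T = 1%:M /\ \det Q = 1.

(* The first m coordinates of y : 'rV_m.+1 are y (widen_ord _ i), the last one
   is y ord_max. *)
Definition exterior_profile (R : realType) (m : nat) (a eta : 'I_m -> R) :
    set 'rV[R]_m.+1 :=
  [set y | \sum_(i < m) eta i * `|y ord0 (widen_ord (leqnSn m) i)| `^ a i
           < y ord0 ord_max].

(* The constants eta are an argument, not existentially quantified, because the
   bounds are uniform over all domains sharing the same a and eta.  The rigid
   motion sending x0 to 0 is x |-> (x - x0) *m Q.  Vectors are rows. *)
Definition exterior_convex_at (R : realType) (m : nat) (a eta : 'I_m -> R)
    (Om : set 'rV[R]_m.+1) (x0 : 'rV[R]_m.+1) :=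
  exists2 Q : 'M[R]_m.+1, rotation Q &
    [set (x - x0) *m Q | x in Om] `<=` exterior_profile a eta.

Definition exterior_convex_domain (R : realType) (m : nat) (a eta : 'I_m -> R)
    (Om : set 'rV[R]_m.+1) :=
  forall x0, bdry Om x0 -> exterior_convex_at a eta Om x0.

(* Main.v *)
(* Write the domain in the coordinates of the exterior condition at x0 and let ht
   be the last coordinate, b = 1 + sum_i 1/a_i.  Both parts follow from
   |u| <= C ht^lam, valid for super-solutions as soon as lam < 1 and
   lam (n - q) <= 2 b: the height at x0 is at most |x - x0|.  For the estimate let
   K be the supremum of |u| / (ht + eps)^lam, nearly attained at z, and put
   T = ht z + eps, h = |u z|.  The slopes p (in rotated coordinates) with
   |p_i| <= c h T^(-1/a_i) and -p_n of order h / T form a box of volume of order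
   h^n T^(-b).  Each is the slope of a supporting hyperplane of u at some y in Om
   where |u y| >= h/2 + c h ht y / T; since |u y| <= K (ht y + eps)^lam with
   lam < 1, this forces ht y + eps <= C T.  These contact points fill a volume at
   most C T^b, and the Monge-Ampere inequality gives
   h^n T^(-b) <= C (K T^lam)^q T^b, that is K^(n-q) <= C T^(2b - lam (n-q)). *)
Require Import Defs.
From mathcomp Require Import all_boot all_order all_algebra.
From mathcomp Require Import all_classical all_reals all_analysis.
From mathcomp Require Import measurable_realfun ring lra.

Import Order.TTheory GRing.Theory Num.Theory.
Import numFieldNormedType.Exports.

Local Open Scope classical_set_scope.
Local Open Scope ring_scope.

Set Implicit Arguments.
Unset Strict Implicit.
Unset Printing Implicit Defensive.

(** * Lebesgue outer measure of boxes and orthogonal images *)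

(* Induction on the dimension: integrate the inequality for the slices over the
   last coordinate.  P selects the boxes that meet the current slice. *)
Lemma nat_box_cover_vol (R : realType) m (a b : nat -> R)
    (A B : nat -> nat -> R) (P : nat -> bool) :
  (forall j, a j <= b j) -> (forall k j, A k j <= B k j) ->
  (forall x : nat -> R, (forall j, (j < m)%N -> a j <= x j < b j) ->
     exists2 k, P k & forall j, (j < m)%N -> A k j <= x j < B k j) ->
  ((\prod_(j < m) (b j - a j))%:E <=
   \sum_(k <oo) ((P k)%:R * \prod_(j < m) (B k j - A k j))%:E)%E.
Proof.
move=> ab AB; have v0 n k : 0 <= (P k)%:R * \prod_(j < n) (B k j - A k j).
  by rewrite mulr_ge0// prodr_ge0// => j _; rewrite subr_ge0.
elim: m P v0 => [|m IH] P v0 cov.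
  (* In dimension 0 every product is 1, and the cover hypothesis at any point gives one selected
     box, whose term alone is already 1. *)
  have [//|k Pk _] := cov a.
  rewrite big_ord0.
  apply: le_trans (nneseries_lim_ge k.+1 _); last first.
    by move=> i _ _; rewrite lee_fin v0.
  rewrite big_nat_recr//= Pk big_ord0 mulr1 leeDr//.
  by apply: sume_ge0 => i _; rewrite lee_fin v0.
pose D := [set` `[a m, b m[] : set R.
pose f k (x : R) := (((P k)%:R * \prod_(j < m) (B k j - A k j))%:E *
  (\1_[set` `[A k m, B k m[] x)%:E)%E.
have mD : measurable D by exact: measurable_itv.
have f0 k x : (0 <= f k x)%E by rewrite /f mule_ge0// lee_fin v0.
have mf k : measurable_fun D (f k).
  apply: measurable_funeM; apply/measurable_EFinP.
  exact: measurable_indic.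
have slice x : D x ->
    ((\prod_(j < m) (b j - a j))%:E <= \sum_(k <oo) f k x)%E.
  rewrite /D /= in_itv /= => xD.
  have v0' n k : 0 <= (P k && (A k m <= x < B k m))%:R *
                      \prod_(j < n) (B k j - A k j).
    by rewrite mulr_ge0// prodr_ge0// => j _; rewrite subr_ge0.
  have /(IH _ v0') : forall y : nat -> R,
      (forall j, (j < m)%N -> a j <= y j < b j) ->
      exists2 k, P k && (A k m <= x < B k m) &
        forall j, (j < m)%N -> A k j <= y j < B k j.
    move=> y yab.
    have [j|k Pk kcov] := cov (fun j => if (j < m)%N then y j else x).
      rewrite ltnS leq_eqVlt => /orP[/eqP->|jm]; first by rewrite ltnn.
      by rewrite jm yab.
    exists k; first by rewrite Pk; have := kcov m (leqnn _); rewrite ltnn.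
    by move=> j jm; have := kcov j (leqW jm); rewrite jm.
  move=> /le_trans; apply;
    apply: lee_nneseries => [k _ _|k _]; first by rewrite lee_fin.
  rewrite /f -EFinM lee_fin indicE mem_setE in_itv /= -mulnb natrM.
  by rewrite mulrAC.
have := ge0_le_integral lebesgue_measure mD
  (f1 := cst (\prod_(j < m) (b j - a j))%:E) (f2 := fun x => (\sum_(k <oo) f k x)%E).
move=> /(_ _ _ _ slice); rewrite integral_cst//= => H.
have muI (c d : R) : c <= d -> lebesgue_measure [set` `[c, d[] = (d - c)%:E.
  move=> cd; rewrite lebesgue_measure_itv /= lte_fin.
  by case: ltgtP cd => // -> _; rewrite subrr.
rewrite big_ord_recr /= EFinM -muI//; apply: le_trans (H _ _ _) _.
- by move=> x _; rewrite lee_fin prodr_ge0// => j _; rewrite subr_ge0.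
- exact: measurable_cst.
- by apply: (@ge0_emeasurable_sum _ _ _ _ f xpredT) => // k x _ _; exact: f0.
rewrite integral_nneseries//.
apply: lee_nneseries => [k _ _|k _].
  by apply: integral_ge0 => x _; exact: f0.
rewrite ge0_integralZl_EFin//; last first.
  by apply/measurable_EFinP; exact: measurable_indic.
rewrite integral_indic// big_ord_recr /= mulrA [leRHS]EFinM.

(* The integral runs over [D] only, so the last side of the [k]-th box enters through its
   intersection with [D]. *)
apply: lee_wpmul2l; rewrite ?lee_fin ?v0//.
by rewrite -muI// le_measure ?inE//; exact: measurableI.
Qed.

(** Coordinates are read through [inord], which turns rows into functions on [nat], the form suited
    to induction on the dimension. *)
Lemma box_vol_le_leb_outer (R : realType) m (I : 'rV[R]_m.+1 * 'rV[R]_m.+1) :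
  (forall j, I.1 ord0 j <= I.2 ord0 j) ->
  ((box_vol I)%:E <= leb_outer (box I))%E.
Proof.
move=> I12; apply: le_ereal_inf_tmp => _ [K [K12 cov] <-].
have := @nat_box_cover_vol R m.+1 (fun j => I.1 ord0 (inord j))
  (fun j => I.2 ord0 (inord j)) (fun k j => (K k).1 ord0 (inord j))
  (fun k j => (K k).2 ord0 (inord j)) xpredT (fun j => I12 _)
  (fun k j => K12 _ _).
have vol (J : 'rV[R]_m.+1 * 'rV[R]_m.+1) :
    \prod_(j < m.+1) (J.2 ord0 (inord j) - J.1 ord0 (inord j)) = box_vol J.
  by apply: eq_bigr => j _; rewrite inord_val.
rewrite vol; under eq_eseriesr do rewrite vol mul1r.
apply=> x xI.
have [j|k _ xK] := cov (\row_j x j).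
  by rewrite mxE; have := xI j (ltn_ord j); rewrite inord_val.
by exists k => // j jm; have := xK (inord j); rewrite mxE inordK.
Qed.

Lemma leb_outer_box_le (R : realType) m (I : 'rV[R]_m.+1 * 'rV[R]_m.+1) :
  (forall j, I.1 ord0 j <= I.2 ord0 j) ->
  (leb_outer (box I) <= (box_vol I)%:E)%E.
Proof.
(* The cover is completed by degenerate boxes, of volume 0 because the dimension is positive. *)
move=> I12; pose K (k : nat) : 'rV[R]_m.+1 * 'rV[R]_m.+1 :=
  if k is 0%N then I else (0, 0).
have vol0 : box_vol (0 : 'rV[R]_m.+1, 0 : 'rV[R]_m.+1) = 0.
  by rewrite /box_vol big_ord_recl /= mxE subrr mul0r.
have K12 k j : (K k).1 ord0 j <= (K k).2 ord0 j by case: k.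
have Kge0 k : (0 <= (box_vol (K k))%:E)%E.
  by rewrite lee_fin prodr_ge0// => j _; rewrite subr_ge0.
apply: ereal_inf_lbound; exists K.
  by split=> // x xI; exists 0%N.
rewrite nneseries_recl//= eseries0 ?adde0//.
by case=> // k _ _ /=; rewrite vol0.
Qed.

Lemma leb_outer_le_fin_cover (R : realType) m (F : finType)
    (J : F -> 'rV[R]_m.+1 * 'rV[R]_m.+1) (A : set 'rV[R]_m.+1) :
  (forall f j, (J f).1 ord0 j <= (J f).2 ord0 j) ->
  (forall x, A x -> exists f, box (J f) x) ->
  (leb_outer A <= (\sum_f box_vol (J f))%:E)%E.
Proof.
move=> J12 cov.
apply: (@le_trans _ _ (leb_outer (\big[setU/set0]_f box (J f)))).
  apply: le_leb_outer => x /cov[f fx].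
  by rewrite (bigD1 f)//=; left.
rewrite -sumEFin; elim/big_ind2: _ => [|A1 v1 A2 v2 h1 h2|f _].
- by rewrite leb_outer0.
- exact: le_trans (outer_measureU2 (@leb_outer R m) _ _) (leeD h1 h2).
- exact: leb_outer_box_le.
Qed.

Lemma orthogonal_entry_le1 (R : realType) n (Q : 'M[R]_n) i j :
  Q *m Q^T = 1%:M -> `|Q i j| <= 1.
Proof.
move=> /(congr1 (fun M : 'M[R]_n => M i i)); rewrite !mxE eqxx => QQ.
rewrite -(@ler_pXn2r _ 2)// ?nnegrE// expr1n -normrX ger0_norm ?sqr_ge0//.
rewrite -[leRHS]QQ (bigD1 j)//= mxE -expr2 lerDl.
by apply: sumr_ge0 => k _; rewrite mxE -expr2 sqr_ge0.
Qed.

(* Cut the box into at most prod_j (2 l_j / e) cubes of side e, the shortest side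
   of the box; the rotated cubes lie in axis-parallel cubes of side 3 n e.  The
   exact rotation invariance of Lebesgue measure is not needed. *)
Lemma leb_outer_orthogonal_box (R : realType) m (Q : 'M[R]_m.+1)
    (I : 'rV[R]_m.+1 * 'rV[R]_m.+1) :
  Q *m Q^T = 1%:M -> (forall j, I.1 ord0 j <= I.2 ord0 j) ->
  (leb_outer [set x *m Q | x in box I] <=
   ((6 * m.+1%:R) ^+ m.+1 * box_vol I)%:E)%E.
Proof.
move=> QQ I12.
have vol0 : 0 <= box_vol I by apply: prodr_ge0 => j _; rewrite subr_ge0.
pose l j := I.2 ord0 j - I.1 ord0 j.
pose j0 := [arg min_(j < (ord0 : 'I_m.+1)) l j]%O.
have lmin j : l j0 <= l j.
  by rewrite /j0; case: Order.TotalTheory.arg_minP => // i _; exact.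
pose e := l j0.
have : 0 <= e by rewrite subr_ge0.
(* If the shortest side is 0, the half-open box is empty. *)
rewrite le_eqVlt => /predU1P[/esym/eqP|e0].
  rewrite subr_eq0 => /eqP e0.
  rewrite (_ : [set _ | _ in _] = set0) ?leb_outer0 ?lee_fin ?mulr_ge0//.
  apply/seteqP; split=> // y [x /(_ j0) + _]; rewrite e0 => /andP[x1 x2].
  by have := le_lt_trans x1 x2; rewrite ltxx.
pose N j := (Num.truncn (l j / e)).+1.
pose F := {dffun forall j : 'I_m.+1, 'I_(N j)}.
pose c (f : F) : 'rV[R]_m.+1 := \row_j (I.1 ord0 j + (f j : nat)%:R * e).
(* A point of a small cube differs from its corner [c f] by at most [e] in each coordinate, so their
   images differ by at most [m.+1 * e]. The upper margin is doubled to get the strict inequality of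
   a half-open box. *)
pose J (f : F) := (c f *m Q - const_mx (m.+1%:R * e),
                   c f *m Q + const_mx (2 * (m.+1%:R * e))).
have ne0 : 0 < m.+1%:R * e by rewrite mulr_gt0// ltr0n.
have J12 f j : (J f).1 ord0 j <= (J f).2 ord0 j by rewrite !mxE; lra.
have volJ f : box_vol (J f) = (3 * (m.+1%:R * e)) ^+ m.+1.
  rewrite /box_vol (eq_bigr (fun=> 3 * (m.+1%:R * e))).
    by rewrite prodr_const card_ord.
  by move=> j _; rewrite !mxE; ring.
have cardF : #|{: F}| = (\prod_(j < m.+1) N j)%N.
  rewrite card_dep_ffun foldrE big_map big_enum /=.
  by apply: eq_bigr => j _; rewrite card_ord.
have cover := @leb_outer_le_fin_cover R m F J [set x *m Q | x in box I] J12.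
apply: (le_trans (cover _)).
  move=> _ [x xI <-].
  have xl j : 0 <= (x ord0 j - I.1 ord0 j) / e.
    by have /andP[xIj _] := xI j; apply: divr_ge0; rewrite subr_ge0 //; exact: I12.
  have xN j : (Num.truncn ((x ord0 j - I.1 ord0 j) / e) < N j)%N.
    rewrite ltnS (le_truncn (R := R))//; rewrite ler_pM2r ?invr_gt0// lerD2r.
    by have /andP[_ /ltW] := xI j.
  pose f : F := [ffun j : 'I_m.+1 => Ordinal (xN j)].
  exists f; have xc j : 0 <= x ord0 j - c f ord0 j <= e.
    rewrite mxE ffunE /=; have := truncn_itv (xl j).
    rewrite ler_pdivlMr// ltr_pdivrMr// -natr1.
    by move=> /andP[? ?]; apply/andP; split; lra.
  move=> j; have : `|((x - c f) *m Q) ord0 j| <= m.+1%:R * e.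
    rewrite mxE (le_trans (ler_norm_sum _ _ _))//.
    rewrite (@le_trans _ _ (\sum_(i < m.+1) e))//; last first.
      by rewrite sumr_const card_ord mulr_natl.
    apply: ler_sum => i _; rewrite normrM -[leRHS]mulr1 ler_pM//; last first.
      exact: orthogonal_entry_le1.
    by rewrite [X in `|X|]mxE [X in _ + X]mxE;
      have /andP[? ?] := xc i; rewrite ger0_norm.
  rewrite mulmxBl [X in `|X|]mxE [X in _ + X]mxE ler_norml => /andP[h1 h2].
  rewrite [X in X <= _]mxE [X in _ + X <= _]mxE [X in _ - X <= _]mxE.
  rewrite [X in _ < X]mxE [X in _ < _ + X]mxE.
  by apply/andP; split; lra.
rewrite (eq_bigr _ (fun f _ => volJ f)) sumr_const cardF lee_fin.
rewrite -[leLHS]mulr_natl natr_prod.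
rewrite (_ : (3 * (m.+1%:R * e)) ^+ m.+1 =
    \prod_(j < m.+1) (3 * (m.+1%:R * e))); last first.
  by rewrite prodr_const card_ord.
rewrite (_ : (6 * m.+1%:R) ^+ m.+1 = \prod_(j < m.+1) (6 * m.+1%:R)); last first.
  by rewrite prodr_const card_ord.
rewrite -!big_split /=; apply: ler_prod => j _.
apply/andP; split; first by do 2 apply: mulr_ge0 => //; exact: ltW.
(* The extra cube coming from rounding up costs [e], which is at most [l j] by the choice of [e]. *)
have le2 : (N j)%:R * e <= 2 * l j.
  have lj : 0 <= l j / e by apply: divr_ge0; apply: ltW => //; exact: lt_le_trans (lmin j).
  have /andP[+ _] := truncn_itv lj; rewrite ler_pdivlMr// => h.
  have := lmin j; rewrite -/e /N -(natr1 (Num.truncn _)) mulrDl mul1r => le; lra.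
rewrite mulrCA [(N j)%:R * _]mulrCA mulrA.
rewrite (_ : 6 * _ * _ = 3 * m.+1%:R * (2 * l j)); last by rewrite /l; ring.
by rewrite ler_wpM2l.
Qed.

(** The estimate for single boxes is summed over an arbitrary cover of [A]. *)
Lemma leb_outer_orthogonal (R : realType) m (Q : 'M[R]_m.+1)
    (A : set 'rV[R]_m.+1) :
  Q *m Q^T = 1%:M ->
  (leb_outer [set x *m Q | x in A] <=
   ((6 * m.+1%:R) ^+ m.+1)%:E * leb_outer A)%E.
Proof.
move=> QQ; set K := (6 * _) ^+ _; have K0 : 0 < K by rewrite exprn_gt0// mulr_gt0.
rewrite -lee_pdivrMl//; apply: le_ereal_inf_tmp => _ [I [I12 cov] <-].
rewrite lee_pdivrMl// -nneseriesZl; last first.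
  by move=> i _; rewrite lee_fin prodr_ge0// => j _; rewrite subr_ge0.
apply: (@le_trans _ _ (leb_outer (\bigcup_k [set x *m Q | x in box (I k)]))).
  apply: le_leb_outer => _ [x /cov[k _ xk] <-].
  by exists k => //; exists x.
apply: le_trans (leb_outer_sigma_subadditive _) _.
apply: lee_nneseries => [i _ _|i _]; first exact: leb_outer_ge0.
by rewrite -EFinM; exact: leb_outer_orthogonal_box.
Qed.

Import HBNNSimple.

(* Neither E nor f has to be measurable: a simple function below f on E and below
   0 elsewhere is supported in a measurable subset of E. *)
Lemma integral_leb_le (R : realType) m (E : set 'rV[R]_m.+1)
    (f : 'rV[R]_m.+1 -> R) (c : R) :
  0 <= c -> (forall x, E x -> 0 <= f x <= c) ->
  (\int[@leb R m]_(x in E) (f x)%:E <= c%:E * leb_outer E)%E.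
Proof.
move=> c0 fc; rewrite ge0_integralE; last by move=> x /fc/andP[]; rewrite lee_fin.
apply: ge_ereal_sup => _ [h hf <-].
pose S := h @^-1` (~` [set 0]).
have mS : measurable S by by apply: (measurable_funPTI h); exact: measurableC.
have SE : S `<=` E.
  move=> x hx0; apply: contrapT => nE; apply: hx0.
  have := hf x; rewrite patchE memNset// lee_fin => hx.
  by apply/eqP; rewrite eq_le hx fun_ge0.
rewrite -integralT_nnsfun.
apply: (@le_trans _ _ (\int[@leb R m]_x (c%:E * (\1_S x)%:E))%E).
  apply: ge0_le_integral => //.
  - by move=> x _; rewrite lee_fin.
  - exact/measurable_EFinP.
  - by apply: measurable_funeM; apply/measurable_EFinP; exact: measurable_indic.
  move=> x _; rewrite indicE; case: (boolP (x \in S)) => [|xS].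
    rewrite inE => /SE xE; have := hf x; rewrite patchE mem_set// mule1.
    by move=> /le_trans; apply; rewrite lee_fin; have /andP[] := fc x xE.
  rewrite mule0 lee_fin; have [->//|/eqP hx0] := eqVneq (h x) 0.
  by move: xS; rewrite notin_setE => /(_ hx0).
rewrite ge0_integralZl_EFin//; last first.
  by apply/measurable_EFinP; exact: measurable_indic.
rewrite integral_indic// setIT; apply: lee_wpmul2l; first by rewrite lee_fin.
exact: le_leb_outer.
Qed.

(** * Convex functions vanishing on the boundary *)

Lemma entry_le_norm (R : realType) n (x : 'rV[R]_n) j : `|x ord0 j| <= `|x|.
Proof.
rewrite [leRHS]/Num.norm /= mx_normrE.
exact: (le_bigmax _ (fun i : 'I_1 * 'I_n => `|x i.1 i.2|) (ord0, j)).
Qed.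

Lemma dotpE (R : realType) n (x y : 'rV[R]_n) : dotp x y = (x *m y^T) 0 0.
Proof. by rewrite mxE; apply: eq_bigr => j _; rewrite mxE. Qed.

Lemma dotp_orthogonal (R : realType) n (Q : 'M[R]_n) (x y : 'rV[R]_n) :
  Q *m Q^T = 1%:M -> dotp (x *m Q) (y *m Q) = dotp x y.
Proof. by move=> QQ; rewrite !dotpE trmx_mul -mulmxA (mulmxA Q) QQ mul1mx. Qed.

Lemma dotpBr (R : realType) n (p x y : 'rV[R]_n) :
  dotp p (x - y) = dotp p x - dotp p y.
Proof. by rewrite !dotpE linearB mulmxBr !mxE. Qed.

Lemma entry_le_euclid_norm (R : realType) n (x : 'rV[R]_n) j :
  x ord0 j <= euclid_norm x.
Proof.
rewrite (le_trans (ler_norm _))// -sqrtr_sqr ler_sqrt.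
  rewrite /dotp (bigD1 j)//= expr2 lerDl.
  by apply: sumr_ge0 => i _; rewrite -expr2 sqr_ge0.
by apply: sumr_ge0 => i _; rewrite -expr2 sqr_ge0.
Qed.

Lemma euclid_norm_orthogonal (R : realType) n (Q : 'M[R]_n) (x : 'rV[R]_n) :
  Q *m Q^T = 1%:M -> euclid_norm (x *m Q) = euclid_norm x.
Proof. by move=> QQ; rewrite /euclid_norm dotp_orthogonal. Qed.

Lemma dotp_continuous (R : realType) n (p : 'rV[R]_n) : continuous (dotp p).
Proof.
apply: continuous_big => [|j _ x]; first exact: add_continuous.
by apply: continuousM; [exact: cst_continuous|exact: coord_continuous].
Qed.

Lemma mulmx_entry_dotp (R : realType) n (Q : 'M[R]_n) (x : 'rV[R]_n) j :
  (x *m Q) ord0 j = dotp (\row_i Q i j) x.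
Proof. by rewrite mxE; apply: eq_bigr => i _; rewrite mxE mulrC. Qed.

Lemma le_on_closure (T : topologicalType) (R : realType) (f : T -> R)
    (A : set T) c :
  continuous f -> (forall x, A x -> f x <= c) ->
  forall x, closure A x -> f x <= c.
Proof.
move=> fc fA x; have cl : closed (f @^-1` [set r | r <= c]).
  by apply: preimage_closed => [y _|]; [exact: fc|exact: closed_le].
have := @closure_subset _ A _ (fA : A `<=` f @^-1` [set r | r <= c]).
by rewrite -((closure_id _).1 cl); exact.
Qed.

Lemma bounded_setP (R : realType) n (A : set 'rV[R]_n) :
  bounded_set A -> exists M, forall x, A x -> `|x| <= M.
Proof. by move=> [M [_ AM]]; exists (M + 1) => x; apply: AM; rewrite ltrDl. Qed.

Lemma compact_closure (R : realType) n (A : set 'rV[R]_n) :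
  bounded_set A -> compact (closure A).
Proof.
move=> bA; apply: bounded_closed_compact; last exact: closed_closure.
have [M AM] := bounded_setP bA.
exists M; split; first exact: num_real.
move=> N MN x /(le_on_closure (@norm_continuous _ _) AM) xM.
exact: le_trans xM (ltW MN).
Qed.

Lemma bdry_open (T : topologicalType) (A : set T) x :
  open A -> closure A x -> ~ A x -> bdry A x.
Proof. by move=> oA clx nAx; split=> //; rewrite ((interior_id A).1 oA). Qed.

Lemma open_shift (R : realType) n (A : set 'rV[R]_n) (c e : 'rV[R]_n) :
  open A -> A c -> exists2 r, 0 < r & A (c + r *: e) /\ A (c - r *: e).
Proof.
move=> oA Ac; have : nbhs c A by exact: open_nbhs_nbhs.
(* Adding 1 to the norm of [e] keeps the quotient meaningful when [e = 0]. *)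
move=> /nbhs_normP[d /= d0 dA]; pose r := d / 2 / (`|e| + 1).
have e1 : 0 < `|e| + 1 by rewrite ltr_wpDl.
have r0 : 0 < r by rewrite !divr_gt0.
have re : `|r *: e| < d.
  rewrite normrZ gtr0_norm//.
  have re1 : r * (`|e| + 1) = d / 2 by rewrite /r divfK// gt_eqF.
  have : r * `|e| < r * (`|e| + 1) by rewrite ltr_pM2l// ltrDl.
  by rewrite re1; lra.
exists r => //; split; apply: dA => /=.
  by rewrite opprD addNKr normrN.
by rewrite opprB addrC subrK.
Qed.

(** A point of the closure with maximal first coordinate cannot lie in the open set. This makes the
    infimum in the distance to the boundary range over a nonempty set. *)
Lemma bdry_neq0 (R : realType) n (A : set 'rV[R]_n.+1) :
  open A -> bounded_set A -> A !=set0 -> bdry A !=set0.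
Proof.
move=> oA bA [a Aa].
have [|c] := @EVT_max_rV _ _ (fun x : 'rV[R]_n.+1 => x ord0 ord0) _ _
  (compact_closure bA) (continuous_subspaceT (@coord_continuous _ _ _ _ _)).
  by exists a; exact: subset_closure.
rewrite inE => clc cmax; exists c; apply: bdry_open => // Ac.
have [r r0 [Ar _]] := open_shift (delta_mx 0 0) oA Ac.
have := cmax _ (mem_set (subset_closure Ar)).
by rewrite !mxE eqxx mulr1 gerDl leNgt r0.
Qed.

(** Maximum principle: a positive value of [u] would give a small strictly convex perturbation of
    [u] a maximum inside [A], against convexity at a midpoint, since its boundary values are too
    small. *)
Lemma convex_dirichlet_le0 (R : realType) n (A : set 'rV[R]_n.+1)
    (u : 'rV[R]_n.+1 -> R) :
  open A -> bounded_set A -> convex_continuous A u -> dirichlet0 A u ->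
  forall x, A x -> u x <= 0.
Proof.
move=> oA bA [cu cvx] u0 x Ax; rewrite leNgt; apply/negP => ux.
have [M AM] := bounded_setP bA.
have AMc := le_on_closure (@norm_continuous _ _) AM.
have M0 : 0 <= M by exact: le_trans (normr_ge0 x) (AM _ Ax).
(* With this [d] the perturbation is below [u x / 2] wherever the first coordinate is at most [M] in
   absolute value, so the maximum is not on the boundary. *)
pose d := u x / 2 / (M ^+ 2 + 1).
have M1 : 0 < M ^+ 2 + 1 by rewrite ltr_wpDl ?sqr_ge0.
have d0 : 0 < d by rewrite !divr_gt0.
(* The perturbation makes u strictly convex in the first coordinate. *)
pose g (y : 'rV[R]_n.+1) := d * (y ord0 ord0 * y ord0 ord0).
have cg : continuous g.
  move=> y; apply: (@continuousM _ _ (cst d)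
    (fun y : 'rV[R]_n.+1 => y ord0 ord0 * y ord0 ord0) y).
    exact: cst_continuous.
  by apply: continuousM; exact: coord_continuous.
have cf : {within closure A, continuous (u + g)}.
  by apply: within_continuousD => //; exact: continuous_subspaceT.
have [|c] := EVT_max_rV _ (compact_closure bA) cf.
  by exists x; exact: subset_closure.
rewrite inE => clc cmax; have [Ac|nAc] := pselect (A c).
  have [r r0 [Ar1 Ar2]] := open_shift (delta_mx 0 0) oA Ac.
  set e := delta_mx 0 0 in Ar1 Ar2.
  have : u (2^-1 *: (c + r *: e) + (1 - 2^-1) *: (c - r *: e)) <=
      2^-1 * u (c + r *: e) + (1 - 2^-1) * u (c - r *: e).
    have h0 : 0 <= 2^-1 :> R by [].
    have h1 : 2^-1 <= 1 :> R by rewrite invf_le1// ler1n.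
    exact: cvx (Itv01 h0 h1) _ _ (mem_set Ar1) (mem_set Ar2).
  have -> : 2^-1 *: (c + r *: e) + (1 - 2^-1) *: (c - r *: e) = c.
    have -> : 1 - 2^-1 = 2^-1 :> R by field.
    rewrite scalerBr scalerDr addrACA subrr addr0 -scalerDl.
    by rewrite (_ : 2^-1 + 2^-1 = 1) ?scale1r//; field.
  have := cmax _ (mem_set (subset_closure Ar1)).
  have := cmax _ (mem_set (subset_closure Ar2)).
  rewrite !fctE /g !mxE eqxx /= => h1 h2 h3.
  have : 0 < d * (r * r) by apply: mulr_gt0 => //; exact: mulr_gt0.
  by move: h1 h2 h3; rewrite !mulr1; lra.
have := cmax _ (mem_set (subset_closure Ax)).
have uc : u c = 0 by apply: u0; exact: bdry_open.
have cM : `|c ord0 ord0| <= M.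
  exact: le_trans (entry_le_norm _ _) (AMc _ clc).
have c2 : c ord0 ord0 * c ord0 ord0 <= M ^+ 2.
  by rewrite -expr2 -real_normK ?num_real// lerXn2r// nnegrE.
have dM : d * (M ^+ 2 + 1) = u x / 2 by rewrite /d divfK// gt_eqF.
have : 0 <= d * (x ord0 ord0 * x ord0 ord0).
  by apply: mulr_ge0; [exact: ltW|rewrite -expr2 sqr_ge0].
rewrite !fctE /g uc; move: c2; rewrite -(ler_pM2l d0).
move: dM; rewrite mulrDr; lra.
Qed.

(** Lower the hyperplane of slope [p] until it supports [u], that is, minimize [u - dotp p] on the
    closure. On the boundary [u = 0], and [k < - u z] makes the value there larger than at [z], so
    the minimizer is interior. *)
Lemma contact_point (R : realType) n (A : set 'rV[R]_n) (u : 'rV[R]_n -> R)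
    (p z : 'rV[R]_n) k :
  open A -> bounded_set A -> {within closure A, continuous u} ->
  dirichlet0 A u -> A z -> (forall y, A y -> dotp p (y - z) <= k) ->
  k < - u z ->
  exists y, [/\ A y, subdiff A u y p & u y <= u z + dotp p (y - z)].
Proof.
move=> oA bA cu u0 Az pk kz.
have [|||y] := @EVT_min_rV _ _ (u - dotp p) (closure A).
- by exists z; exact: subset_closure.
- exact: compact_closure.
- apply: within_continuousB => //; apply: continuous_subspaceT.
  exact: dotp_continuous.
rewrite inE => cly ymin.
have yz : u y <= u z + dotp p (y - z).
  have := ymin z (mem_set (subset_closure Az)).
  by rewrite dotpBr !fctE; lra.
have Ay : A y.
  apply: contrapT => nAy; have uy : u y = 0 by apply: u0; exact: bdry_open.
  have : dotp p y <= k + dotp p z.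
    apply: le_on_closure cly; first exact: dotp_continuous.
    by move=> w /pk; rewrite dotpBr; lra.
  by move: yz; rewrite uy dotpBr; lra.
exists y; split=> // x Ax.
have := ymin x (mem_set (subset_closure Ax)).
by rewrite dotpBr !fctE; lra.
Qed.

(** * The height estimate *)

(** The left side [s] satisfies [s <= 1] or [s <= s]^ a[, and]s [^ a] is the last term on the
    right. *)
Lemma powR_scaled_le (R : realType) (a T t : R) : 1 <= a -> 0 < T ->
  `|t| * T `^ (- a^-1) <= 1 + `|t| `^ a / T.
Proof.
move=> a1 T0; set s := _ * _; have s0 : 0 <= s by rewrite mulr_ge0// powR_ge0.
have <- : s `^ a = `|t| `^ a / T.
  rewrite powRM ?powR_ge0// -powRrM mulNr mulVf ?powR_inv1 ?ltW//.
  by rewrite gt_eqF// (lt_le_trans ltr01).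
have [s1|/ltW s1] := leP s 1; first by rewrite (le_trans s1)// lerDl powR_ge0.
by rewrite (le_trans (le1r_powR s1 a1))// lerDr.
Qed.

(* The bound on the slopes pi is dual to the profile: on a section of height T the
   i-th coordinate is of size T `^ (1 / a i). *)
Lemma slope_term_bound (R : realType) m (a eta w pi : 'I_m -> R) (k wn h T : R) :
  (forall i, 1 <= a i) -> (forall i, 0 < eta i) -> 0 < h -> 0 < T -> 0 <= k ->
  \sum_i eta i * `|w i| `^ a i <= wn ->
  (forall i, `|pi i| <= k * Num.min 1 (eta i) * h * T `^ (- (a i)^-1)) ->
  `|\sum_i pi i * w i| <= k * h * m%:R + k * (h / T) * wn.
Proof.
move=> a1 eta0 h0 T0 k0 wwn pik.
apply: le_trans (ler_norm_sum _ _ _) _.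
have kT : 0 <= k * (h / T) by rewrite mulr_ge0// divr_ge0// ltW.
apply: le_trans (lerD (lexx _) (ler_wpM2l kT wwn)).
rewrite mulr_sumr (_ : k * h * m%:R = \sum_(i < m) k * h); last first.
  by rewrite sumr_const card_ord mulr_natr.
rewrite -big_split /=; apply: ler_sum => i _.
rewrite normrM (le_trans (ler_wpM2r _ (pik i)))//.
rewrite -[leLHS]mulrA [T `^ _ * _]mulrC.
have m0 : 0 <= Num.min 1 (eta i) by rewrite le_min ler01 ltW.
have kmh : 0 <= k * Num.min 1 (eta i) * h by rewrite !mulr_ge0// ltW.
rewrite (le_trans (ler_wpM2l kmh (powR_scaled_le (w i) (a1 i) T0)))//.
rewrite mulrDr mulr1 lerD//.
  apply: ler_wpM2r; first exact: ltW.
  by apply: ler_piMr; rewrite // ge_min lexx.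
rewrite (_ : k * _ * h * (_ / T) =
  k * (h / T) * (Num.min 1 (eta i) * `|w i| `^ a i)); last by ring.
by rewrite ler_wpM2l// ler_wpM2r ?powR_ge0// ge_min lexx orbT.
Qed.

(** Here [s] is minus the vertical slope. The tangential slopes contribute at most
    [h / 8 + h / T * yn / 16], and the vertical one at most [h / 4 - h / T * yn / 8], so a decay in
    [yn] survives. *)
Lemma touching_bound (R : realType) m (a eta y z pi : 'I_m -> R)
    (yn zn h T s : R) :
  (forall i, 1 <= a i) -> (forall i, 0 < eta i) -> 0 < h -> 0 < T ->
  0 <= yn -> 0 <= zn <= T ->
  \sum_i eta i * `|y i| `^ a i <= yn -> \sum_i eta i * `|z i| `^ a i <= zn ->
  (forall i, `|pi i| <=
     (16 * m.+1%:R)^-1 * Num.min 1 (eta i) * h * T `^ (- (a i)^-1)) ->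
  h / T / 8 <= s <= h / T / 4 ->
  \sum_i pi i * (y i - z i) - s * (yn - zn) <= h / 2 - h / T * yn / 16.
Proof.
move=> a1 eta0 h0 T0 yn0 /andP[zn0 znT] hy hz hpi /andP[s1 s2].
set k := (16 * _)^-1 in hpi.
have m0 : 0 < 16 * m.+1%:R :> R by rewrite mulr_gt0.
have k0 : 0 < k by rewrite invr_gt0.
(* Using [m.+1] in [k] leaves a spare [k] for each of the two tangential sums; this absorbs the term
   [k * h] bounded in [e3]. *)
have km : k * m%:R = 16^-1 - k.
  have : k * (16 * m.+1%:R) = 1 by rewrite mulVf// gt_eqF.
  by rewrite -(natr1 m); lra.
have k16 : k <= 16^-1 by rewrite -subr_ge0 -km mulr_ge0// ltW.
have th0 : 0 < h / T by rewrite divr_gt0.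
have thT : h / T * T = h by rewrite divfK// gt_eqF.
have /ler_normlP[_ Hy] := slope_term_bound a1 eta0 h0 T0 (ltW k0) hy hpi.
have /ler_normlP[Hz _] := slope_term_bound a1 eta0 h0 T0 (ltW k0) hz hpi.
have -> : \sum_i pi i * (y i - z i) = \sum_i pi i * y i - \sum_i pi i * z i.
  by rewrite -sumrB; apply: eq_bigr => i _; rewrite mulrBr.
move: th0 thT s1 s2 Hy Hz; set th := h / T => th0 thT s1 s2 Hy Hz.
have kh : k * h * m%:R = h / 16 - k * h by rewrite mulrAC km; lra.
have e1 : k * th * yn <= th * yn / 16.
  rewrite -mulrA [leRHS]mulrC; apply: ler_wpM2r => //.
  by apply: mulr_ge0 => //; exact: ltW.
have e2 : th * zn <= h by rewrite -thT ler_pM2l.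
have e3 : k * th * zn <= k * h by rewrite -mulrA ler_pM2l.
have e4 : th / 8 * yn <= s * yn by rewrite ler_wpM2r.
have e5 : s * zn <= th / 4 * zn by rewrite ler_wpM2r.
have e6 : 0 < k * h by rewrite mulr_gt0.
by move: Hy Hz; rewrite kh; lra.
Qed.

(** The Monge-Ampère inequality on [E], read in rotated coordinates. The rotation constant appears
    twice: once for the set of slopes and once for the set of contact points. *)
Lemma subdiff_box_volume (R : realType) m (q c : R) (Q : 'M[R]_m.+1)
    (x0 : 'rV[R]_m.+1) (I J : 'rV[R]_m.+1 * 'rV[R]_m.+1)
    (Om E : set 'rV[R]_m.+1) (u : 'rV[R]_m.+1 -> R) :
  Q *m Q^T = 1%:M ->
  (forall j, I.1 ord0 j <= I.2 ord0 j) -> (forall j, J.1 ord0 j <= J.2 ord0 j) ->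
  aleksandrov_supersolution q Om u -> <<s open >> E -> E `<=` Om ->
  0 <= c -> (forall y, E y -> `|u y| `^ q <= c) ->
  (forall y, E y -> box I ((y - x0) *m Q)) ->
  (forall p, box J (p *m Q) -> exists2 y, E y & subdiff Om u y p) ->
  box_vol J <= ((6 * m.+1%:R) ^+ m.+1) ^+ 2 * (c * box_vol I).
Proof.
move=> QQ I12 J12 [_ superu] sE EOm c0 uc EI PJ.
have QtQ : Q^T *m Q = 1%:M by exact: mulmx1C.
set C := (6 * _) ^+ _; have C0 : 0 <= C by rewrite exprn_ge0// mulr_ge0.
pose P := [set p | box J (p *m Q)].
have PsubMA : (leb_outer P <= MA Om u E)%E.
  by apply: le_leb_outer => p /PJ[y Ey yp]; exists y.
have JP : ((box_vol J)%:E <= C%:E * leb_outer P)%E.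
  apply: le_trans (box_vol_le_leb_outer J12) _.
  apply: le_trans (leb_outer_orthogonal P QQ).
  apply: le_leb_outer => p Jp; exists (p *m Q^T).
    by rewrite /P /= -mulmxA QtQ mulmx1.
  by rewrite -mulmxA QtQ mulmx1.
have MAE : (MA Om u E <= c%:E * leb_outer E)%E.
  apply: le_trans (superu E sE EOm) _; apply: integral_leb_le => // y Ey.
  by rewrite powR_ge0 uc.
pose I' := (I.1 + x0 *m Q, I.2 + x0 *m Q).
have EI' : (leb_outer E <= C%:E * (box_vol I)%:E)%E.
  have -> : box_vol I = box_vol I'.
    by apply: eq_bigr => j _; rewrite /= !mxE; lra.
  have I'12 j : I'.1 ord0 j <= I'.2 ord0 j by rewrite !mxE lerD2r.
  rewrite -EFinM; apply: le_trans (leb_outer_orthogonal_box (Q := Q^T) _ I'12).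
    apply: le_leb_outer => y /EI yI; exists (y *m Q).
      move=> j; have := yI j; rewrite mulmxBl !mxE.
      by rewrite lerBrDr ltrBlDr.
    by rewrite -mulmxA QQ mulmx1.
  by rewrite trmxK.
rewrite -lee_fin; apply: (le_trans JP).
apply: (@le_trans _ _ (C%:E * (c%:E * (C%:E * (box_vol I)%:E)))%E).
  apply: lee_wpmul2l; first by rewrite lee_fin.
  apply: (le_trans PsubMA); apply: (le_trans MAE).
  by apply: lee_wpmul2l; first by rewrite lee_fin.
by rewrite -!EFinM lee_fin expr2 -!mulrA [c * (C * _)]mulrCA.
Qed.

Lemma growth_constant_bound (R : realType) (n q lam b h K T A B : R) :
  0 < T -> 0 < h -> 0 < K -> 0 < A -> 0 <= n ->
  K * T `^ lam < 2 * h ->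
  A * (h `^ n * T `^ (- b)) <= B * (K `^ q * T `^ (lam * q)) * T `^ b ->
  K `^ (n - q) <= 2 `^ n * B / A * T `^ (2 * b - lam * (n - q)).
Proof.
move=> T0 h0 K0 A0 n0 Kh AB.
have Tp x : 0 < T `^ x by exact: powR_gt0.
have Kp x : 0 < K `^ x by exact: powR_gt0.
have Tn : T != 0 by rewrite gt_eqF.
have Kn : K != 0 by rewrite gt_eqF.
have KT : K `^ n * T `^ (lam * n) <= 2 `^ n * h `^ n.
  have [[K0' h0'] Tl] := (ltW K0, ltW h0, powR_ge0 T lam).
  rewrite powRrM -!powRM//; apply: ge0_ler_powR; rewrite ?nnegrE ?mulr_ge0//.
  exact: ltW.
rewrite powRB ?Kn ?implybT// ler_pdivrMr// -(ler_pM2r (Tp (lam * n))).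
apply: (le_trans KT).
have -> : T `^ (2 * b - lam * (n - q)) =
    T `^ b * T `^ b * T `^ (lam * q) / T `^ (lam * n).
  rewrite -!powRD ?Tn ?implybT// -powRB ?Tn ?implybT//.
  by congr (_ `^ _); ring.
have -> : 2 `^ n * B / A * (T `^ b * T `^ b * T `^ (lam * q) / T `^ (lam * n)) *
    K `^ q * T `^ (lam * n) =
    2 `^ n * (B * (K `^ q * T `^ (lam * q)) * T `^ b * T `^ b / A).
  by field; rewrite !gt_eqF.
rewrite ler_wpM2l ?powR_ge0// ler_pdivlMr//.
rewrite -(ler_pM2r (Tp b)) in AB; apply: le_trans AB.
by rewrite powRN -!mulrA mulVf ?gt_eqF// mulr1 mulrC.
Qed.

Lemma exterior_profile_gt0 (R : realType) m (a eta : 'I_m -> R) y :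
  (forall i, 0 < eta i) -> exterior_profile a eta y -> 0 < y ord0 ord_max.
Proof.
move=> eta0; apply: le_lt_trans; apply: sumr_ge0 => i _.
by rewrite mulr_ge0 ?powR_ge0// ltW.
Qed.

(** The height is one coordinate of the rotated vector, and the rotation preserves the Euclidean
    norm. *)
Lemma height_powR_le (R : realType) m (a eta : 'I_m -> R) (Q : 'M[R]_m.+1)
    (Om : set 'rV[R]_m.+1) x0 x lam :
  (forall i, 0 < eta i) -> 0 <= lam -> Q *m Q^T = 1%:M ->
  [set (x - x0) *m Q | x in Om] `<=` exterior_profile a eta -> Om x ->
  (((x - x0) *m Q) ord0 ord_max) `^ lam <= euclid_norm (x - x0) `^ lam.
Proof.
move=> eta0 lam0 QQ prof Omx; apply: ge0_ler_powR => //.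
- by rewrite nnegrE ltW//;
  apply: (exterior_profile_gt0 eta0 (a := a)); apply: prof; exists x.
- by rewrite nnegrE sqrtr_ge0.
- by rewrite (le_trans (entry_le_euclid_norm _ _))// euclid_norm_orthogonal.
Qed.

(** Builds box corners in the coordinate split of [exterior_profile]: the tangential entries are
    [F], the height is [c]. *)
Definition snoc_row (R : realType) m (F : 'I_m -> R) (c : R) : 'rV[R]_m.+1 :=
  \row_j oapp F c (unlift ord_max j).

Lemma snoc_row_widen (R : realType) m (F : 'I_m -> R) c i :
  snoc_row F c ord0 (widen_ord (leqnSn m) i) = F i.
Proof.
rewrite mxE (_ : widen_ord _ i = lift ord_max i) ?liftK//.
by apply: ord_inj; rewrite lift_max.
Qed.

Lemma snoc_row_max (R : realType) m (F : 'I_m -> R) c :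
  snoc_row F c ord0 ord_max = c.
Proof. by rewrite mxE unlift_none. Qed.

Definition snoc_rowE := (snoc_row_widen, snoc_row_max).

Lemma ord_widen_ind m (P : 'I_m.+1 -> Prop) :
  (forall i, P (widen_ord (leqnSn m) i)) -> P ord_max -> forall j, P j.
Proof.
move=> Pw Pm j; case: (unliftP ord_max j) => [i|] ->//.
rewrite (_ : lift ord_max i = widen_ord (leqnSn m) i)//.
by apply: ord_inj; rewrite lift_max.
Qed.

Lemma prodr_powR (R : realType) (I : finType) (T : R) (f : I -> R) :
  0 < T -> \prod_i T `^ f i = T `^ (\sum_i f i).
Proof.
move=> T0; apply/esym/(big_morph (powR T)) => [x y|]; last exact: powRr0.
by rewrite powRD// (gt_eqF T0) implybT.
Qed.

Lemma le_powR_fixpoint (R : realType) (c w lam : R) :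
  0 < w -> lam < 1 -> w <= c * w `^ lam -> w <= c `^ (1 - lam)^-1.
Proof.
move=> w0 l1 wc; have l0 : 0 < 1 - lam by rewrite subr_gt0.
have w1 : w `^ (1 - lam) <= c.
  have wn : w != 0 by rewrite gt_eqF.
  rewrite powRB ?wn ?implybT// powRr1 ?(ltW w0)// ler_pdivrMr//.
  exact: powR_gt0.
have <- : (w `^ (1 - lam)) `^ (1 - lam)^-1 = w.
  by rewrite -powRrM mulfV ?gt_eqF// powRr1 ?(ltW w0).
apply: ge0_ler_powR; rewrite ?nnegrE ?powR_ge0// ?invr_ge0 ?(ltW l0)//.
by rewrite (le_trans _ w1)// powR_ge0.
Qed.

(** All terms of the profile sum are nonnegative, so each one is at most [B]; this gives the width
    of a section of height [B]. *)
Lemma profile_coord_bound (R : realType) m (a eta y : 'I_m -> R) (yn B : R) i :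
  (forall i, 1 <= a i) -> (forall i, 0 < eta i) ->
  \sum_i eta i * `|y i| `^ a i <= yn -> yn <= B ->
  `|y i| <= (B / eta i) `^ (a i)^-1.
Proof.
move=> a1 eta0 yyn ynB.
have ai0 : 0 < a i by exact: lt_le_trans (a1 i).
have yi : `|y i| `^ a i <= B / eta i.
  rewrite ler_pdivlMr// mulrC (le_trans _ ynB)// (le_trans _ yyn)//.
  rewrite (bigD1 i)//= lerDl; apply: sumr_ge0 => j _.
  by rewrite mulr_ge0 ?powR_ge0// ltW.
rewrite -[leLHS]powRr1// -[X in _ `^ X](@mulfV _ (a i)) ?gt_eqF// powRrM.
apply: ge0_ler_powR; rewrite ?nnegrE ?powR_ge0// ?invr_ge0 ?(ltW ai0)//.
by rewrite (le_trans _ yi)// powR_ge0.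
Qed.

Lemma dotp_snoc (R : realType) m (p v : 'rV[R]_m.+1) :
  dotp p v = \sum_(i < m) p ord0 (widen_ord (leqnSn m) i) *
                          v ord0 (widen_ord (leqnSn m) i)
             + p ord0 ord_max * v ord0 ord_max.
Proof. by rewrite /dotp big_ord_recr. Qed.

(* K is the best constant in |u| <= K (ht + eps)^lam up to the factor 2, and z a
   point where it is nearly attained.  The contact set of the slopes in J then
   stays in the section E of height comparable to T, and both volumes are explicit
   powers of T. *)
Lemma growth_constant_exists (R : realType) m (q lam : R) (a eta : 'I_m -> R) :
  0 <= q -> (forall i, 1 <= a i) -> (forall i, 0 < eta i) -> 0 < lam < 1 ->
  let n : R := m.+1%:R in
  let b := \sum_i (a i)^-1 + 1 in
  exists2 A : R, 0 <= A &
    forall (Om : set 'rV[R]_m.+1) (u : 'rV[R]_m.+1 -> R) x0 (Q : 'M[R]_m.+1)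
        (eps K : R) z,
      let ht y := ((y - x0) *m Q) ord0 ord_max in
      bounded_convex_domain Om -> aleksandrov_supersolution q Om u ->
      dirichlet0 Om u -> Q *m Q^T = 1%:M ->
      [set (x - x0) *m Q | x in Om] `<=` exterior_profile a eta ->
      0 < eps -> 0 < K -> (forall y, Om y -> `|u y| <= K * (ht y + eps) `^ lam) ->
      Om z -> K * (ht z + eps) `^ lam < 2 * `|u z| ->
      K `^ (n - q) <= A * (ht z + eps) `^ (2 * b - lam * (n - q)).
Proof.
move=> q0 a1 eta0 /andP[lam0 lam1] n b.
pose L : R := 32 `^ (1 - lam)^-1.
have L0 : 0 < L by exact: powR_gt0.
pose k i : R := (16 * m.+1%:R)^-1 * Num.min 1 (eta i).
have k0 i : 0 < k i by rewrite mulr_gt0 ?invr_gt0 ?mulr_gt0// lt_min ltr01 eta0.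
pose g i : R := (2 * L / eta i) `^ (a i)^-1.
have g0 i : 0 < g i by rewrite powR_gt0// divr_gt0// mulr_gt0.
pose A0 := (\prod_i (2 * k i)) / 8.
have A00 : 0 < A0 by rewrite divr_gt0// prodr_gt0// => i _; rewrite mulr_gt0.
pose B := ((6 * m.+1%:R) ^+ m.+1) ^+ 2 *
  (((2 * L) `^ lam) `^ q * ((\prod_i (4 * g i)) * (2 * L))).
have B0 : 0 <= B.
  rewrite mulr_ge0 ?sqr_ge0// mulr_ge0 ?powR_ge0// mulr_ge0 ?mulr_ge0 ?(ltW L0)//.
  by apply: prodr_ge0 => i _; rewrite mulr_ge0// ltW.
exists (2 `^ n * B / A0) => [|Om u x0 Q eps K z ht].
  by rewrite divr_ge0 ?(ltW A00)// mulr_ge0// powR_ge0.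
move=> [oOm _ bOm _] super u0 QQ prof eps0 K0 uK Omz Kz.
have uneg := convex_dirichlet_le0 oOm bOm super.1 u0.
have absu y : Om y -> `|u y| = - u y by move=> /uneg; exact: ler0_norm.
pose co y i := ((y - x0) *m Q) ord0 (widen_ord (leqnSn m) i).
have hprof y : Om y -> \sum_i eta i * `|co y i| `^ a i < ht y.
  by move=> Omy; apply: prof; exists y.
have ht0 y : Om y -> 0 <= ht y.
  move=> Omy; apply/ltW/(exterior_profile_gt0 eta0 (a := a)).
  by apply: prof; exists y.
set T := ht z + eps in Kz *.
have T0 : 0 < T by rewrite ltr_wpDl ?ht0.
set h := `|u z| in Kz.
have h0 : 0 < h.
  have := lt_trans (mulr_gt0 K0 (powR_gt0 lam T0)) Kz.
  by rewrite pmulr_rgt0.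
have th0 : 0 < h / T by rewrite divr_gt0.
pose J := (snoc_row (fun i => - (k i * h * T `^ (- (a i)^-1))) (- (h / T / 4)),
           snoc_row (fun i => k i * h * T `^ (- (a i)^-1)) (- (h / T / 8))).
(* [I] encloses the section of height [2 * L * T]. The half-widths are doubled so that non-strict
   coordinate bounds fit in a half-open box. *)
pose I := (snoc_row (fun i => - (2 * (g i * T `^ (a i)^-1))) 0,
           snoc_row (fun i => 2 * (g i * T `^ (a i)^-1)) (2 * L * T)).
have kh0 i : 0 < k i * h * T `^ (- (a i)^-1).
  by apply: mulr_gt0; [exact: mulr_gt0|exact: powR_gt0].
have gT0 i : 0 < g i * T `^ (a i)^-1 by apply: mulr_gt0 => //; exact: powR_gt0.
have LT0 : 0 < L * T by exact: mulr_gt0.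
have J12 j : J.1 ord0 j <= J.2 ord0 j.
  elim/ord_widen_ind: j => [i|]; rewrite !snoc_rowE; last lra.
  by have := kh0 i; lra.
have I12 j : I.1 ord0 j <= I.2 ord0 j.
  elim/ord_widen_ind: j => [i|]; rewrite !snoc_rowE; last by rewrite -mulrA; lra.
  by have := gT0 i; lra.
(* Contact points satisfy [ht y + eps <= L * T]; relaxing this to a strict bound by [2 * L * T]
   makes [E] open, hence Borel. *)
pose E := Om `&` [set y | ht y < 2 * L * T - eps].
have oE : open E.
  apply: openI => //.
  apply: (@open_comp _ _ ht [set r | r < 2 * L * T - eps]); last exact: open_lt.
  move=> y _; rewrite (_ : ht = fun y =>
      dotp (\row_i Q i ord_max) y - (x0 *m Q) ord0 ord_max).
    by apply: continuousB; [exact: dotp_continuous|exact: cst_continuous].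
  by apply/funext => w; rewrite /ht mulmxBl [LHS]mxE [X in _ + X]mxE mulmx_entry_dotp.
have Ebox y : E y -> box I ((y - x0) *m Q).
  move=> [Omy /= yLTe]; have yLT : ht y < 2 * L * T by lra.
  elim/ord_widen_ind => [i|]; rewrite !snoc_rowE; last first.
    by rewrite ht0.
  have := profile_coord_bound i a1 eta0 (ltW (hprof y Omy)) (ltW yLT).
  rewrite mulrAC powRM ?(ltW T0) ?divr_ge0 ?mulr_ge0 ?(ltW L0) ?(ltW (eta0 i))//.
  rewrite -/(g i) ler_norml => /andP[h1 h2]; have := gT0 i => h3.
  by apply/andP; split; rewrite /co in h1 h2; lra.
have touch p y : box J (p *m Q) -> Om y ->
    dotp p (y - z) <= h / 2 - h / T * ht y / 16.
  move=> pJ Omy; rewrite -(dotp_orthogonal p (y - z) QQ) dotp_snoc.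
  have coB j : ((y - z) *m Q) ord0 j =
      ((y - x0) *m Q) ord0 j - ((z - x0) *m Q) ord0 j.
    by rewrite !mulmxBl !mxE; lra.
  rewrite coB; under eq_bigr do rewrite coB.
  have := @touching_bound R m a eta (co y) (co z)
    (fun i => (p *m Q) ord0 (widen_ord (leqnSn m) i)) (ht y) (ht z) h T
    (- (p *m Q) ord0 ord_max) a1 eta0 h0 T0 (ht0 y Omy).
  rewrite mulNr opprK; apply.
  - by rewrite ht0//= /T lerDl ltW.
  - exact/ltW/hprof.
  - exact/ltW/hprof.
  - move=> i; have := pJ (widen_ord (leqnSn m) i); rewrite !snoc_rowE.
    by move=> /andP[p1 /ltW p2]; rewrite ler_norml p1 p2.
  - have := pJ ord_max; rewrite !snoc_rowE => /andP[p1 /ltW p2].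
    by apply/andP; split; lra.
have uz : u z = - h by rewrite /h absu// opprK.
have PE p : box J (p *m Q) -> exists2 y, E y & subdiff Om u y p.
  move=> pJ.
  have [||y [Omy yp uy]] :=
    @contact_point _ _ _ u p z (h / 2) oOm bOm super.1.1 u0 Omz.
  - move=> y Omy; apply: le_trans (touch p y pJ Omy) _.
    by rewrite gerBl divr_ge0// mulr_ge0 ?ht0// ltW.
  - by rewrite uz opprK; lra.
  exists y => //; split=> //.
  have Y0 : 0 < ht y + eps by rewrite ltr_wpDl ?ht0.
  have w0 : 0 < (ht y + eps) / T by rewrite divr_gt0.
  suff /(le_powR_fixpoint w0 lam1) :
      (ht y + eps) / T <= 32 * ((ht y + eps) / T) `^ lam.
    by rewrite -/L ler_pdivrMr//= => ?; rewrite -mulrA; lra.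
  (* Write [ht y + eps] as [T] times the ratio and use the near-optimality at [z]. *)
  have KY : K * (ht y + eps) `^ lam <= 2 * h * ((ht y + eps) / T) `^ lam.
    rewrite powRM ?invr_ge0 ?(ltW T0) ?(ltW Y0)// mulrA mulrAC.
    rewrite ler_wpM2r ?powR_ge0// -powR_inv1 ?(ltW T0)// -powRrM mulN1r powRN.
    by rewrite ler_pdivlMr ?powR_gt0// ltW.
  have := le_trans (uK y Omy) KY; rewrite (absu y Omy).
  have := touch p y pJ Omy; move: uy; rewrite uz.
  (* This error is absorbed by the term [h / 2] that remains in the contact inequality, which is
     worth [8 * h] after multiplication by 16. *)
  have epsT : h / T * eps <= h.
    by rewrite -[leRHS](@divfK _ T) ?gt_eqF// ler_pM2l// /T lerDr ht0.
  have -> : (ht y + eps) / T = h^-1 * (h / T * ht y + h / T * eps).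
    by field; rewrite !gt_eqF.
  by move=> h1 h2 h3; rewrite ler_pdivrMl//; lra.
have uE y : E y ->
    `|u y| `^ q <= K `^ q * (((2 * L) `^ lam) `^ q * T `^ (lam * q)).
  move=> [Omy /= yLT].
  rewrite mulrA powRrM -powRM ?powR_ge0 ?(ltW K0)//.
  rewrite -powRM ?mulr_ge0 ?powR_ge0 ?(ltW K0)//.
  apply: ge0_ler_powR; rewrite ?nnegrE ?mulr_ge0 ?powR_ge0 ?(ltW K0)//.
  apply: le_trans (uK y Omy) _; rewrite -mulrA ler_wpM2l ?(ltW K0)//.
  rewrite -powRM ?mulr_ge0 ?(ltW L0) ?(ltW T0)//.
  apply: ge0_ler_powR; rewrite ?nnegrE ?(ltW lam0)//.
  - by rewrite addr_ge0 ?ht0 ?(ltW eps0).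
  - by rewrite !mulr_ge0 ?(ltW L0) ?(ltW T0).
  by lra.
have Tn : T != 0 by rewrite gt_eqF.
have c0 : 0 <= K `^ q * (((2 * L) `^ lam) `^ q * T `^ (lam * q)).
  by rewrite !mulr_ge0 ?powR_ge0.
have sE : <<s open >> E by exact: sub_gen_smallest.
have := subdiff_box_volume QQ I12 J12 super sE (@subIsetl _ _ _) c0 uE Ebox PE.
have volJ : box_vol J = A0 * (h `^ n * T `^ (- b)).
  rewrite /box_vol big_ord_recr /= !snoc_rowE.
  rewrite (eq_bigr (fun i => 2 * k i * (h * T `^ (- (a i)^-1)))); last first.
    by move=> i _; rewrite !snoc_rowE; ring.
  rewrite big_split /= [\prod_i (h * _)]big_split /=.
  rewrite prodr_const card_ord prodr_powR// sumrN.
  rewrite /b opprD powRD ?Tn ?implybT// powR_inv1 ?(ltW T0)//.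
  rewrite powR_mulrn ?(ltW h0)// exprSr /A0; by field; rewrite gt_eqF.
have volI : box_vol I = (\prod_i (4 * g i)) * (2 * L) * T `^ b.
  rewrite /box_vol big_ord_recr /= !snoc_rowE.
  rewrite (eq_bigr (fun i => 4 * g i * T `^ (a i)^-1)); last first.
    by move=> i _; rewrite !snoc_rowE; ring.
  rewrite big_split /= prodr_powR// subr0.
  rewrite /b powRD ?Tn ?implybT// powRr1 ?(ltW T0)//.
  by ring.
rewrite volJ volI => vol.
apply: (growth_constant_bound T0 h0 K0 A00 _ Kz (B := B)) => //.
apply: le_trans vol _; rewrite le_eqVlt; apply/orP; left; apply/eqP.
by rewrite /B; ring.
Qed.

(** Ensures that the [sup] in [euclid_diam] is a true supremum and not a default value. *)
Lemma euclid_dist_has_ubound (R : realType) n (A : set 'rV[R]_n) :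
  bounded_set A -> has_ubound [set euclid_norm (x - y) | x in A & y in A].
Proof.
move=> /bounded_setP[M AM]; exists (Num.sqrt (\sum_(j < n) (2 * M) ^+ 2)).
move=> _ [x Ax [y Ay <-]]; rewrite /euclid_norm ler_wsqrtr//.
apply: ler_sum => j _; rewrite -expr2 -real_normK ?num_real//.
have xyM : `|(x - y) ord0 j| <= 2 * M.
  rewrite (le_trans (entry_le_norm _ _))// (le_trans (ler_normB _ _))//.
  by have := AM _ Ax; have := AM _ Ay; lra.
by rewrite lerXn2r// nnegrE// (le_trans _ xyM).
Qed.

(** The diameter is taken over [A] while [x0] is only in its closure; the bound is linear in the
    second point, so it passes to the closure. *)
Lemma height_le_diam (R : realType) n (A : set 'rV[R]_n.+1) (Q : 'M[R]_n.+1)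
    x0 z j :
  bounded_set A -> Q *m Q^T = 1%:M -> closure A x0 -> A z ->
  ((z - x0) *m Q) ord0 j <= euclid_diam A.
Proof.
move=> bA QQ clx0 Az.
rewrite mulmxBl [leLHS]mxE [X in _ + X]mxE !mulmx_entry_dotp.
set p := \row_i Q i j.
suff : dotp (- p) x0 <= euclid_diam A - dotp p z.
  by rewrite [dotp (- p) _]dotpE mulNmx mxE -dotpE; lra.
apply: le_on_closure clx0 => [|w Aw]; first exact: dotp_continuous.
rewrite dotpE mulNmx mxE -dotpE lerBrDr addrC -dotpBr -mulmx_entry_dotp.
rewrite (le_trans (entry_le_euclid_norm _ _))// euclid_norm_orthogonal//.
by apply: (ub_le_sup (euclid_dist_has_ubound bA)); exists z => //; exists w.
Qed.

(** [K] is taken as the supremum of the quotients defining the best constant. Since the exponent [c]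
    is nonnegative, the bound on [K] in powers of [T] becomes uniform once [T] is bounded by the
    diameter. *)
Lemma height_estimate (R : realType) m (q lam diam : R) (a eta : 'I_m -> R) :
  0 <= q -> q < m.+1%:R -> (forall i, 1 <= a i) -> (forall i, 0 < eta i) ->
  0 < lam < 1 -> lam * (m.+1%:R - q) <= \sum_(i < m) 2 / a i + 2 ->
  exists2 C : R, 0 < C &
    forall (Om : set 'rV[R]_m.+1) (u : 'rV[R]_m.+1 -> R) x0 (Q : 'M[R]_m.+1),
      bounded_convex_domain Om -> euclid_diam Om = diam ->
      aleksandrov_supersolution q Om u -> dirichlet0 Om u ->
      closure Om x0 -> Q *m Q^T = 1%:M ->
      [set (x - x0) *m Q | x in Om] `<=` exterior_profile a eta ->
      forall x, Om x ->
        `|u x| <= C * (((x - x0) *m Q) ord0 ord_max) `^ lam.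
Proof.
move=> q0 qn a1 eta0 lam01 lamn.
have [A A0 HA] := growth_constant_exists q0 a1 eta0 lam01.
move: HA; set n : R := m.+1%:R; set b := \sum_i (a i)^-1 + 1 => HA.
have bE : \sum_(i < m) 2 / a i + 2 = 2 * b.
  by rewrite /b mulrDr mulr1 mulr_sumr.
have /andP[lam0 lam1] := lam01.
pose c := 2 * b - lam * (n - q).
have c0 : 0 <= c by rewrite /c -bE subr_ge0.
have nq0 : 0 < n - q by rewrite subr_gt0.
(* With [eps = ht x], the quantity [T = ht z + eps] is at most [2 * diam]. *)
pose K0 := (A * (2 * diam) `^ c) `^ (n - q)^-1.
have K00 : 0 <= K0 by exact: powR_ge0.
exists (2 * K0 + 1) => [|Om u x0 Q dOm diamE super u0 clx0 QQ prof x Omx].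
  by rewrite ltr_wpDl// mulr_ge0.
have [oOm _ bOm _] := dOm.
pose ht y := ((y - x0) *m Q) ord0 ord_max.
have ht0 y : Om y -> 0 < ht y.
  by move=> Omy; apply: (exterior_profile_gt0 eta0 (a := a)); apply: prof; exists y.
have htd y : Om y -> ht y <= diam.
  by move=> Omy; rewrite -diamE; exact: height_le_diam.
have uneg := convex_dirichlet_le0 oOm bOm super.1 u0.
have absu y : Om y -> `|u y| = - u y by move=> /uneg; exact: ler0_norm.
rewrite -/(ht x).
(* The choice eps = ht x spares a limit eps -> 0. *)
have [eps [eps0 epsE]] : exists e, 0 < e /\ e = ht x by exists (ht x); rewrite ht0.
have hte y : Om y -> 0 < ht y + eps by move=> /ht0 ?; exact: addr_gt0.
have Yp y : Om y -> 0 < (ht y + eps) `^ lam by move=> /hte; exact: powR_gt0.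
pose S := [set `|u y| / (ht y + eps) `^ lam | y in Om].
(* Boundedness of [u] and [eps > 0] make the supremum [K] finite. *)
have [M [M0 uM]] : exists M, 0 <= M /\ forall y, Om y -> `|u y| <= M.
  have [||d _ dmin] := @EVT_min_rV _ _ u (closure Om) _ _ super.1.1.
  - by exists x; exact: subset_closure.
  - exact: compact_closure.
  exists (- u d); split.
    rewrite oppr_ge0 (le_trans _ (uneg x Omx))//.
    by apply: dmin; rewrite inE; exact: subset_closure.
  move=> y Omy; rewrite absu// lerN2; apply: dmin; rewrite inE.
  exact: subset_closure.
have S0 : S !=set0 by exists (`|u x| / (ht x + eps) `^ lam); exists x.
have bS : has_ubound S.
  exists (M / eps `^ lam) => _ [y Omy <-].
  rewrite ler_pdivrMr ?Yp// -mulrA.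
  rewrite (le_trans (uM y Omy))// ler_peMr// mulrC ler_pdivlMr ?powR_gt0// mul1r.
  apply: ge0_ler_powR; rewrite ?nnegrE ?(ltW lam0) ?(ltW eps0) ?(ltW (hte y Omy))//.
  by rewrite lerDr ltW// ht0.
pose K := sup S.
have uK y : Om y -> `|u y| <= K * (ht y + eps) `^ lam.
  move=> Omy; rewrite -ler_pdivrMr ?Yp//.
  by apply: ub_le_sup => //; exists y.
have KK0 : K <= K0.
  have [/le_trans->//|Kpos] := leP K 0.
  have K2 : 0 < K / 2 by rewrite divr_gt0.
  (* Near-attainment within [K / 2] is the source of the factor 2 in the near-optimality. *)
  have [_ [z Omz <-] Kz] := sup_adherent K2 (conj S0 bS).
  have {}Kz : K * (ht z + eps) `^ lam < 2 * `|u z|.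
    by move: Kz; rewrite -/K ltr_pdivlMr ?Yp//; lra.
  have := HA Om u x0 Q eps K z dOm super u0 QQ prof eps0 Kpos uK Omz Kz.
  rewrite -/(ht z) -/c => KA.
  have {}KA : K `^ (n - q) <= A * (2 * diam) `^ c.
    apply: (le_trans KA); rewrite ler_wpM2l//.
    have := htd z Omz; have := htd x Omx; have := hte z Omz.
    rewrite -epsE => h1 h2 h3.
    by apply: ge0_ler_powR; rewrite ?nnegrE; lra.
  have -> : K = (K `^ (n - q)) `^ (n - q)^-1.
    by rewrite -powRrM mulfV ?gt_eqF// powRr1 ?(ltW Kpos).
  apply: ge0_ler_powR; rewrite ?nnegrE ?powR_ge0 ?invr_ge0 ?(ltW nq0)//.
  by rewrite mulr_ge0// powR_ge0.
apply: le_trans (uK x Omx) _.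
rewrite epsE (_ : ht x + ht x = 2 * ht x); last by lra.
rewrite powRM ?(ltW (ht0 x Omx))// mulrA ler_wpM2r ?powR_ge0//.
have l2 : 2 `^ lam <= 2 :> R by rewrite ler1_powR ?ler1n// ltW.
have l20 : 0 <= 2 `^ lam :> R by exact: powR_ge0.
rewrite (le_trans (ler_wpM2r l20 KK0))// (le_trans (ler_wpM2l K00 l2))//.
by rewrite mulrC lerDl.
Qed.

(** * From heights to the distance to the boundary *)

(** Inverting the power turns the hypothesis into a lower bound for the distance from [x] to every
    boundary point, hence for their infimum. *)
Lemma dist_bdry_estimate (R : realType) n (Om : set 'rV[R]_n.+1) x (v C lam : R) :
  open Om -> bounded_set Om -> Om !=set0 -> 0 <= v -> 0 < C -> 0 < lam ->
  (forall x0, bdry Om x0 -> v <= C * euclid_norm (x - x0) `^ lam) ->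
  v <= C * euclid_dist x (bdry Om) `^ lam.
Proof.
move=> oOm bOm Om0 v0 C0 lam0 H.
have vC0 : 0 <= v / C by rewrite divr_ge0// ltW.
have le : (v / C) `^ lam^-1 <= euclid_dist x (bdry Om).
  apply: lb_le_inf.
    by have [y By] := bdry_neq0 oOm bOm Om0; exists (euclid_norm (x - y)); exists y.
  move=> _ [y By <-].
  rewrite -[leRHS]powRr1 ?sqrtr_ge0// -[X in _ <= _ `^ X](@mulfV _ lam) ?gt_eqF//.
  rewrite powRrM; apply: ge0_ler_powR; rewrite ?nnegrE ?powR_ge0 ?invr_ge0 ?(ltW lam0)//.
  by rewrite ler_pdivrMr// mulrC H.
rewrite mulrC -ler_pdivrMr//.
rewrite -[leLHS]powRr1// -[X in _ `^ X](@mulVf _ lam) ?gt_eqF// powRrM.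
apply: ge0_ler_powR; rewrite ?nnegrE ?powR_ge0 ?(ltW lam0)//.
by rewrite (le_trans _ le)// powR_ge0.
Qed.

Theorem theorem1p4 (R : realType) (m : nat) (q : R) (a eta : 'I_m -> R)
    (n_ge2 : (2 <= m.+1)%N) (q_ge0 : 0 <= q) (q_ltn : q < m.+1%:R)
    (a_ge1 : forall i, 1 <= a i) (eta_gt0 : forall i, 0 < eta i) :
  let n : R := m.+1%:R in
  let abar : R := \sum_(i < m) 2 / a i in
  let alpha : R := (abar + 2) / (n - q) in
  (forall diam lambda : R,
     (0 < n - abar - 2 /\ lambda = (abar + 2) / n) \/
     (n - abar - 2 <= 0 /\ 0 < lambda < 1) ->
     exists2 C : R, 0 < C &
       forall (Om : set 'rV[R]_m.+1) (u : 'rV[R]_m.+1 -> R) (x0 : 'rV[R]_m.+1),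
         bounded_convex_domain Om -> euclid_diam Om = diam ->
         aleksandrov_supersolution q Om u -> dirichlet0 Om u ->
         bdry Om x0 -> exterior_convex_at a eta Om x0 ->
         forall x, Om x -> euclid_dist x (bdry Om) = euclid_norm (x - x0) ->
           `|u x| <= C * euclid_dist x (bdry Om) `^ lambda)
  /\
  (forall diam lambda : R,
     (0 < q < n - abar - 2 /\ 0 < lambda < alpha) \/
     (Num.max (n - abar - 2) 0 <= q /\ 0 < lambda < 1) ->
     exists2 C : R, 0 < C &
       forall (Om : set 'rV[R]_m.+1) (u : 'rV[R]_m.+1 -> R),
         bounded_convex_domain Om -> euclid_diam Om = diam ->
         aleksandrov_solution q Om u -> dirichlet0 Om u ->
         exterior_convex_domain a eta Om ->
         forall x, Om x ->
           `|u x| <= C * euclid_dist x (bdry Om) `^ lambda).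
Proof.
move=> n abar alpha.
have nq0 : 0 < n - q by rewrite subr_gt0.
have abar0 : 0 <= abar.
  by apply: sumr_ge0 => i _; rewrite divr_ge0// (le_trans ler01).
have alphaE : alpha * (n - q) = abar + 2 by rewrite /alpha divfK ?gt_eqF.
have n0 : 0 < n by rewrite ltr0n.
split=> diam lambda hl.
  (* In the first case [lambda * n = abar + 2] and [q >= 0]; in the second [n - q <= n <= abar + 2]
     and [lambda < 1]. *)
  have [l01 ln] : 0 < lambda < 1 /\ lambda * (n - q) <= abar + 2.
    case: hl => [[nab ->]|[nab /[dup] l01 /andP[l0 l1]]]; split=> //.
    - by rewrite divr_gt0 ?ltr_pdivrMr//; lra.
    - rewrite -[leRHS](@divfK _ n) ?gt_eqF// ler_wpM2l ?gerBl//.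
      by rewrite divr_ge0 ?(ltW n0)//; lra.
    - have : lambda * (n - q) <= n - q by rewrite ler_piMl ?ltW.
      by lra.
  have [C C0 HC] := height_estimate diam q_ge0 q_ltn a_ge1 eta_gt0 l01 ln.
  exists C => // Om u x0 dOm diamE super u0 [clx0 _] [Q [QQ _] prof] x Omx ->.
  apply: le_trans (HC Om u x0 Q dOm diamE super u0 clx0 QQ prof x Omx) _.
  have /andP[l0 _] := l01.
  by rewrite ler_wpM2l ?(ltW C0)// (height_powR_le eta_gt0 (ltW l0) QQ prof).
(* In the first case [lambda < alpha] gives [lambda * (n - q) < abar + 2 < n - q], so also
   [lambda < 1]; in the second [n - q <= abar + 2]. *)
have [l01 ln] : 0 < lambda < 1 /\ lambda * (n - q) <= abar + 2.
  case: hl => [[/andP[q0 qab] /andP[l0 la]]|[+ /[dup] l01 /andP[l0 l1]]].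
    have ln : lambda * (n - q) <= abar + 2 by rewrite -alphaE ler_pM2r// ltW.
    split=> //; rewrite l0 -(ltr_pM2r nq0) mul1r; lra.
  rewrite ge_max => /andP[nab _]; split=> //.
  have : lambda * (n - q) <= n - q by rewrite ler_piMl ?ltW.
  by lra.
have [C C0 HC] := height_estimate diam q_ge0 q_ltn a_ge1 eta_gt0 l01 ln.
have /andP[l0 _] := l01.
exists C => // Om u dOm diamE [cu sol] u0 ext x Omx.
have super : aleksandrov_supersolution q Om u.
  by split=> // E sE EOm; rewrite (sol E sE EOm).
have [oOm Om0 bOm _] := dOm.
apply: dist_bdry_estimate => // x0 Bx0.
have [Q [QQ _] prof] := ext x0 Bx0.
apply: le_trans (HC Om u x0 Q dOm diamE super u0 Bx0.1 QQ prof x Omx) _.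
by rewrite ler_wpM2l ?(ltW C0)// (height_powR_le eta_gt0 (ltW l0) QQ prof).
Qed.
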